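(* Let $A,B,C,D\in M_n(\mathbb{C})$ and let $T=\begin{bmatrix}A&B\\C&D\end{bmatrix}\in M_{2n}(\mathbb{C})$. Then for every $p\in[2,\infty)$, $$w_p^p(T)\le\frac{1}{2^{2-p}}\Big(w_p^p(A)+w_p^p(D)+\frac{1}{2^{p-1}}\big[\|B\|_p+\|C\|_p\big]^p\Big).$$ Moreover, if $p\in[1,2]$, then $$w_p^p(T)\le w_p^p(A)+w_p^p(D)+\frac{1}{2^{p-1}}\big[\|B\|_p+\|C\|_p\big]^p.$$
   Context: For $p\in[1,\infty)$, $\|\cdot\|_p$ denotes the Schatten $p$-norm on $M_m(\mathbb{C})$, $\|Y\|_p=(\sum_j s_j(Y)^p)^{1/p}$ with $s_j(Y)$ the singular values of $Y$. The Schatten $p$-generalized numerical radius is $w_p(Y)=\sup_{\theta\in\mathbb{R}}\|\mathrm{Re}(e^{i\theta}Y)\|_p$, where $\mathrm{Re}(Z)=\frac12(Z+Z^* )$. The notation $w_p^p(Y)$ means $(w_p(Y))^p$. *)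

(* Defs.v *)
From HB Require Import structures.
From mathcomp Require Import all_boot all_order all_algebra.
From mathcomp Require Import complex.
From mathcomp Require Import all_classical all_reals all_analysis.

Set Implicit Arguments.
Unset Strict Implicit.
Unset Printing Implicit Defensive.

Import Order.TTheory GRing.Theory Num.Theory.
Local Open Scope ring_scope.
Local Open Scope classical_set_scope.
Local Open Scope sesquilinear_scope.
Local Open Scope complex_scope.

Section SchattenNumericalRadius.
Variables (R : realType) (m : nat).
Implicit Types (Y Z : 'M[R[i]]_m) (p t : R).

(* The singular values of Y, with multiplicity, are the square roots of the
   eigenvalues of Y^* Y. That matrix is Hermitian positive semidefinite, so
   [spectral_diag] lists its (real, nonnegative) eigenvalues. *)
Definition singular_value Y (j : 'I_m) : R :=
  Num.sqrt (complex.Re (spectral_diag (Y ^t* *m Y) 0 j)).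

Definition schatten_norm p Y : R :=
  (\sum_(j < m) singular_value Y j `^ p) `^ p^-1.

Definition re_mx Z : 'M[R[i]]_m := 2^-1 *: (Z + Z ^t*).

Definition expi t : R[i] := cos t +i* sin t.

(* [sup] is the real-valued supremum, which is 0 on unbounded sets; for p >= 1
   the set below is nonempty and bounded. *)
Definition schatten_numrad p Y : R :=
  sup [set schatten_norm p (re_mx (expi t *: Y)) | t in [set: R]].

End SchattenNumericalRadius.

(* Main.v *)
Require Import Defs.
From HB Require Import structures.
From mathcomp Require Import all_boot all_order all_algebra.
From mathcomp Require Import complex.
From mathcomp Require Import all_classical all_reals all_analysis.
From mathcomp Require Import ring lra.

Set Implicit Arguments.
Unset Strict Implicit.
Unset Printing Implicit Defensive.

Import Order.TTheory GRing.Theory Num.Theory.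
Local Open Scope ring_scope.

(** Write S(Y) for the sum of the p-th powers of the singular values of a
    possibly rectangular matrix Y. Two variational principles, both consequences
    of Jensen's inequality for doubly (sub)stochastic weights, suffice.

    For p >= 1, S(Y) is the maximum over contractions K and L of the sum of the
    |(K Y L)_jj|^p. With Minkowski's inequality this yields the triangle
    inequality, and also that Y and its adjoint have the same S.

    Over orthonormal bases (u_j), the sum of the |Y u_j|^p has S(Y) as its
    minimum for p <= 2 and as its maximum for p >= 2. Hence
    S([X Y]) <= S(X) + S(Y) for p <= 2, and stacking X above Y costs at most a
    factor 2^(p/2 - 1) for p >= 2. Splitting a 2 x 2 block matrix once by rows
    and once by columns bounds S of the whole by the sum of S over the blocks,
    times 2^(p - 2) when p >= 2.

    The real part of e^(it) T has diagonal blocks Re(e^(it) A), Re(e^(it) D) and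
    off-diagonal blocks of norm at most (|B|_p + |C|_p) / 2. *)

(** * Jensen and Minkowski inequalities for real powers *)

Section PowerInequalities.
Variable R : realType.

Lemma powR_le_inv (p x y : R) : 0 < p -> 0 <= x -> 0 <= y ->
  x `^ p <= y `^ p -> x <= y.
Proof.
move=> p0 x0 y0; rewrite leNgt => xy; rewrite leNgt; apply: contra xy => yx.
by apply: gt0_ltr_powR; rewrite ?nnegrE.
Qed.

(** Tangent line of the convex function t^p at 1. For p > 1 it is Young's inequality for the product
    t * 1 with exponents p and p / (p - 1). *)
Lemma powR_tangent (p t : R) : 1 <= p -> 0 <= t -> p * t - (p - 1) <= t `^ p.
Proof.
move=> p1 t0; have [->|pN1] := eqVneq p 1; first by rewrite powRr1//; lra.
have p_gt1 : 1 < p by rewrite lt_neqAle eq_sym pN1.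
have p0 : 0 < p by lra.
have q0 : 0 < p / (p - 1) by rewrite divr_gt0// subr_gt0.
have pq : p^-1 + (p / (p - 1))^-1 = 1.
  by rewrite invf_div mulrBl divff ?gt_eqF// mul1r; lra.
have := conjugate_powR t0 ler01 p0 q0 pq.
rewrite powR1 mulr1 mul1r invf_div => tp.
rewrite -(ler_pM2r (x := p^-1)) ?invr_gt0//.
rewrite mulrBl mulrAC divff ?gt_eqF// mul1r; lra.
Qed.

(** After dividing by the mean m, sum the tangent line at 1 over the weights. Total weight below 1
    is harmless: the constant term - (p - 1) is nonpositive and 0^p = 0. *)
Lemma powR_jensen (I : finType) (w s : I -> R) (p : R) : 1 <= p ->
  (forall i, 0 <= w i) -> (forall i, 0 <= s i) -> \sum_i w i <= 1 ->
  (\sum_i w i * s i) `^ p <= \sum_i w i * s i `^ p.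
Proof.
move=> p1 w0 s0 w1; set m := \sum_i w i * s i.
have m0 : 0 <= m by apply: sumr_ge0 => i _; rewrite mulr_ge0.
have [->|mN0] := eqVneq m 0.
  rewrite powR0; last by rewrite gt_eqF//; lra.
  by apply: sumr_ge0 => i _; rewrite mulr_ge0// powR_ge0.
have m_gt0 : 0 < m by rewrite lt_neqAle eq_sym mN0.
have : 1 <= \sum_i w i * (s i / m) `^ p.
  apply: (@le_trans _ _ (\sum_i w i * (p * (s i / m) - (p - 1)))); last first.
    apply: ler_sum => i _; apply: ler_wpM2l => //.
    by apply: powR_tangent => //; rewrite divr_ge0.
  have -> : \sum_i w i * (p * (s i / m) - (p - 1)) =
      p * (m / m) - (p - 1) * \sum_i w i.
    rewrite {1}/m mulr_suml !mulr_sumr -sumrB; apply: eq_bigr => i _.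
    by ring.
  rewrite divff// mulr1; have := ler_wpM2l (_ : 0 <= p - 1) w1.
  by rewrite subr_ge0 => /(_ p1); lra.
have mp : 0 < m `^ p by rewrite powR_gt0.
rewrite -(ler_pM2l mp) mulr1 => /le_trans; apply.
rewrite mulr_sumr le_eqVlt; apply/orP; left; apply/eqP; apply: eq_bigr => i _.
rewrite mulrCA -powRM ?divr_ge0//; congr (_ * _ `^ _).
by rewrite mulrCA divff// mulr1.
Qed.

(** The convex case with exponent 1 / r, applied to the values s_i^r. *)
Lemma powR_jensen_concave (I : finType) (w s : I -> R) (r : R) : 0 < r <= 1 ->
  (forall i, 0 <= w i) -> (forall i, 0 <= s i) -> \sum_i w i <= 1 ->
  \sum_i w i * s i `^ r <= (\sum_i w i * s i) `^ r.
Proof.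
move=> /andP[r0 r1] w0 s0 w1.
have ri : 1 <= r^-1 by rewrite invf_ge1.
have := powR_jensen ri w0 (fun i => powR_ge0 (s i) r) w1.
under [X in _ <= X]eq_bigr do
  rewrite -powRrM divff ?gt_eqF// powRr1//.
set x := \sum_i _ => xy.
have x0 : 0 <= x by apply: sumr_ge0 => i _; rewrite mulr_ge0// powR_ge0.
have -> : x = (x `^ r^-1) `^ r by rewrite -powRrM mulVf ?gt_eqF// powRr1.
apply: ge0_ler_powR; rewrite ?nnegrE ?powR_ge0 ?(ltW r0)//.
by apply: sumr_ge0 => i _; rewrite mulr_ge0.
Qed.

Lemma powR_add_convex (a b r : R) : 1 <= r -> 0 <= a -> 0 <= b ->
  (a + b) `^ r <= 2 `^ (r - 1) * (a `^ r + b `^ r).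
Proof.
move=> r1 a0 b0.
(* Equal weights at the points 2a and 2b, whose mean is a + b. *)
have := @powR_jensen bool (fun=> 2^-1) (fun c => if c then 2 * a else 2 * b) r r1.
rewrite !big_bool/= !mulKf ?pnatr_eq0// => /(_ _ _ _)/le_trans; apply.
- by move=> _; rewrite invr_ge0.
- by case; rewrite mulr_ge0.
- by lra.
- rewrite !powRM// powRB ?pnatr_eq0 ?implybT// powRr1// -mulrDr.
  by rewrite -mulrDr mulrA [2^-1 * _]mulrC.
Qed.

(** Each (x_i + y_i) / (a + b) is the convex combination of x_i / a and y_i / b with weights a / (a
    + b) and b / (a + b). The positive bounds a and b stand in for the norms, which may vanish. *)
Lemma minkowski_sum_aux (I : finType) (x y : I -> R) (p a b : R) : 1 <= p ->
  (forall i, 0 <= x i) -> (forall i, 0 <= y i) -> 0 < a -> 0 < b ->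
  \sum_i x i `^ p <= a `^ p -> \sum_i y i `^ p <= b `^ p ->
  \sum_i (x i + y i) `^ p <= (a + b) `^ p.
Proof.
move=> p1 x0 y0 a0 b0 xa yb.
have ab : 0 < a + b by rewrite addr_gt0.
have abp : 0 < (a + b) `^ p by rewrite powR_gt0.
have sumw : a / (a + b) + b / (a + b) = 1 by rewrite -mulrDl divff ?gt_eqF.
have conv i : (x i + y i) `^ p <=
    (a + b) `^ p * (a / (a + b) * (x i / a) `^ p + b / (a + b) * (y i / b) `^ p).
  have := @powR_jensen bool (fun c => if c then a / (a + b) else b / (a + b))
    (fun c => if c then x i / a else y i / b) p p1.
  rewrite !big_bool/= sumw => /(_ _ _ (lexx _)) J.
  have -> : x i + y i = (a + b) * (a / (a + b) * (x i / a) + b / (a + b) * (y i / b)).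
    by field; rewrite !gt_eqF.
  rewrite powRM ?(ltW ab)//; last first.
    by rewrite addr_ge0// mulr_ge0// divr_ge0// ltW.
  by apply: ler_wpM2l; [exact: ltW|apply: J => -[]; rewrite divr_ge0// ltW].
have norm1 c (z : I -> R) : 0 < c -> (forall i, 0 <= z i) ->
    \sum_i z i `^ p <= c `^ p -> \sum_i (z i / c) `^ p <= 1.
  move=> c0 z0 zc; under eq_bigr do rewrite powRM ?invr_ge0 ?(ltW c0)//.
  rewrite -mulr_suml -[c^-1]powR_inv1 ?(ltW c0)// powRAC powR_inv1 ?powR_ge0//.
  by rewrite ler_pdivrMr ?powR_gt0// mul1r.
apply: (le_trans (ler_sum _ (fun i _ => conv i))).
rewrite -mulr_sumr -[X in _ <= X]mulr1 ler_pM2l// big_split/= -!mulr_sumr -sumw.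
apply: lerD; rewrite -[X in _ <= X]mulr1; apply: ler_wpM2l;
  by [rewrite divr_ge0// ltW|exact: norm1].
Qed.

Lemma minkowski_sum (I : finType) (x y : I -> R) (p : R) : 1 <= p ->
  (forall i, 0 <= x i) -> (forall i, 0 <= y i) ->
  (\sum_i (x i + y i) `^ p) `^ p^-1 <=
  (\sum_i x i `^ p) `^ p^-1 + (\sum_i y i `^ p) `^ p^-1.
Proof.
(* Enlarging each norm by e / 2 makes it positive, so that it can serve as a divisor. *)
move=> p1 x0 y0; apply/ler_addgt0Pr => e e0.
have p0 : p != 0 by rewrite gt_eqF//; lra.
have pp : 0 <= p by lra.
have root (z : I -> R) : \sum_i z i `^ p <= ((\sum_i z i `^ p) `^ p^-1 + e / 2) `^ p.
  rewrite -[X in X <= _]powRr1 ?sumr_ge0//; last by move=> i _; rewrite powR_ge0.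
  rewrite -[X in _ `^ X <= _](mulVf p0) powRrM; apply: ge0_ler_powR; rewrite ?nnegrE//.
  + exact: powR_ge0.
  + by rewrite addr_ge0 ?powR_ge0//; lra.
  + by rewrite lerDl; lra.
have pos (z : I -> R) : 0 < (\sum_i z i `^ p) `^ p^-1 + e / 2.
  by rewrite ltr_wpDl ?powR_ge0//; lra.
move: (pos x) (pos y) (minkowski_sum_aux p1 x0 y0 (pos x) (pos y) (root x) (root y)).
generalize ((\sum_i x i `^ p) `^ p^-1) ((\sum_i y i `^ p) `^ p^-1) => a b a0 b0 M.
apply: (@le_trans _ _ (a + e / 2 + (b + e / 2))); last by lra.
have ab : 0 <= a + e / 2 + (b + e / 2) by lra.
rewrite -[X in _ <= X](powRr1 ab) -[X in _ <= _ `^ X](mulfV p0) powRrM.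
apply: ge0_ler_powR; rewrite ?nnegrE ?powR_ge0 ?invr_ge0//.
by apply: sumr_ge0 => i _; rewrite powR_ge0.
Qed.

End PowerInequalities.

(** * Algebra of the conjugate transpose *)

Section ConjugateTranspose.
Local Open Scope sesquilinear_scope.

Lemma trmxC_mul (C : numClosedFieldType) m n k
  (A : 'M[C]_(m, n)) (B : 'M[C]_(n, k)) : (A *m B) ^t* = B ^t* *m A ^t*.
Proof. by rewrite trmx_mul map_mxM. Qed.

Lemma trmxCB (C : numClosedFieldType) m n (A B : 'M[C]_(m, n)) :
  (A - B) ^t* = A ^t* - B ^t*.
Proof. by rewrite !raddfB. Qed.

Lemma trmxC1 (C : numClosedFieldType) n : (1%:M : 'M[C]_n) ^t* = 1%:M.
Proof. by rewrite trmx1 map_mx1. Qed.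

End ConjugateTranspose.

(** * Euclidean norms of columns *)

Section ColumnNorms.
Import ComplexField.Normc.
Local Open Scope sesquilinear_scope.
Local Open Scope complex_scope.
Variable R : realType.
Local Notation C := R[i].

Lemma normc_ge0 (z : C) : 0 <= normc z.
Proof. by case: z => a b; rewrite /normc sqrtr_ge0. Qed.

Lemma norm_normc (z : C) : `|z| = (normc z)%:C.
Proof. by case: z. Qed.

Lemma normc_conjC (z : C) : normc z^* = normc z.
Proof. by case: z => a b; rewrite /= sqrrN. Qed.

Lemma normc_trmxC m n (A : 'M[C]_(m, n)) i j :
  normc ((A ^t*) i j) = normc (A j i).
Proof. by rewrite !mxE normc_conjC. Qed.

Lemma normc_real (x : R) : 0 <= x -> normc x%:C = x.
Proof. by move=> x0; rewrite /= expr0n addr0 sqrtr_sqr ger0_norm. Qed.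

Lemma normc_sum (I : finType) (F : I -> C) :
  normc (\sum_i F i) <= \sum_i normc (F i).
Proof.
elim/big_ind2 : _ => [|x a y b xa yb|//]; first by rewrite normc0.
by rewrite (le_trans (le_normcD _ _))// lerD.
Qed.

Definition col_sqn m n (A : 'M[C]_(m, n)) (j : 'I_n) : R :=
  \sum_i normc (A i j) ^+ 2.

Lemma col_sqn_ge0 m n (A : 'M[C]_(m, n)) j : 0 <= col_sqn A j.
Proof. by apply: sumr_ge0 => i _; rewrite sqr_ge0. Qed.

Lemma gram_diagE m n (A : 'M[C]_(m, n)) j :
  (A ^t* *m A) j j = (col_sqn A j)%:C.
Proof.
rewrite mxE rmorph_sum; apply: eq_bigr => i _.
by rewrite !mxE -normCKC rmorphXn norm_normc.
Qed.

Lemma col_sqn1 n (j : 'I_n) : col_sqn (1%:M : 'M[C]_n) j = 1.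
Proof.
apply: (@complexI R); rewrite -gram_diagE trmxC1 mul1mx mxE eqxx.
by rewrite rmorph1.
Qed.

Lemma col_sqn_col_mx m1 m2 n (A : 'M[C]_(m1, n)) (B : 'M[C]_(m2, n)) j :
  col_sqn (col_mx A B) j = col_sqn A j + col_sqn B j.
Proof.
rewrite /col_sqn big_split_ord/=.
by congr (_ + _); apply: eq_bigr => i _; rewrite (col_mxEu, col_mxEd).
Qed.

Lemma col_sqn_row_mxl m n1 n2 (A : 'M[C]_(m, n1)) (B : 'M[C]_(m, n2)) j :
  col_sqn (row_mx A B) (lshift n2 j) = col_sqn A j.
Proof. by apply: eq_bigr => i _; rewrite row_mxEl. Qed.

Lemma col_sqn_row_mxr m n1 n2 (A : 'M[C]_(m, n1)) (B : 'M[C]_(m, n2)) j :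
  col_sqn (row_mx A B) (rshift n1 j) = col_sqn B j.
Proof. by apply: eq_bigr => i _; rewrite row_mxEr. Qed.

Lemma col_sqn_gram m1 m2 n (A : 'M[C]_(m1, n)) (B : 'M[C]_(m2, n)) j :
  A ^t* *m A = B ^t* *m B -> col_sqn A j = col_sqn B j.
Proof. by move=> AB; apply: (@complexI R); rewrite -!gram_diagE AB. Qed.

(** * Contractions, partial isometries and unitary matrices *)

Definition col_contraction m n (K : 'M[C]_(m, n)) :=
  forall k (X : 'M[C]_(n, k)) j, col_sqn (K *m X) j <= col_sqn X j.

(** Requiring the bound for the adjoint as well makes the notion self-adjoint by construction, so
    that rows and columns are controlled alike. *)
Definition mx_contraction m n (K : 'M[C]_(m, n)) :=
  col_contraction K /\ col_contraction (K ^t*).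

Lemma contractionC m n (K : 'M[C]_(m, n)) : mx_contraction K -> mx_contraction (K ^t*).
Proof. by case=> K1 K2; split=> //; rewrite trmxCK. Qed.

Lemma contractionM m n k (K : 'M[C]_(m, n)) (L : 'M[C]_(n, k)) :
  mx_contraction K -> mx_contraction L -> mx_contraction (K *m L).
Proof.
move=> [K1 K2] [L1 L2]; split=> q X j.
  by rewrite -mulmxA (le_trans (K1 _ _ _)).
by rewrite trmxC_mul -mulmxA (le_trans (L2 _ _ _)).
Qed.

Lemma contraction_col m n (K : 'M[C]_(m, n)) j : mx_contraction K ->
  \sum_i normc (K i j) ^+ 2 <= 1.
Proof. by case=> + _ => /(_ _ 1%:M j); rewrite mulmx1 col_sqn1. Qed.

Lemma contraction_row m n (K : 'M[C]_(m, n)) i : mx_contraction K ->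
  \sum_j normc (K i j) ^+ 2 <= 1.
Proof.
move=> /contractionC/contraction_col => /(_ i).
by under eq_bigr do rewrite normc_trmxC.
Qed.

(** Pythagoras: the adjoint of W times W is an orthogonal projection, so the Gram matrix of X splits
    into that of W X and that of the component Z of X which W kills. *)
Lemma partial_isometry_contraction m n (W : 'M[C]_(m, n)) :
  W *m W ^t* *m W = W -> mx_contraction W.
Proof.
have half a b (V : 'M[C]_(a, b)) : V *m V ^t* *m V = V -> col_contraction V.
  move=> VVV k X j; pose Z := X - V ^t* *m (V *m X).
  have E : X ^t* *m X = Z ^t* *m Z + (V *m X) ^t* *m (V *m X).
    have VV : V *m (V ^t* *m (V *m X)) = V *m X by rewrite !mulmxA VVV.
    have -> : Z ^t* *m Z = X ^t* *m X - (V *m X) ^t* *m (V *m X); last first.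
      by rewrite subrK.
    rewrite /Z trmxCB trmxC_mul trmxCK mulmxBl !mulmxBr -!mulmxA VV.
    by rewrite [(V *m X) ^t*]trmxC_mul -!mulmxA subrr subr0.
  have := congr1 (fun M : matrix _ k k => M j j) E; rewrite [in RHS]mxE !gram_diagE.
  by rewrite -rmorphD => /complexI ->; rewrite lerDr col_sqn_ge0.
move=> WWW; split; first exact: half.
by apply: half; rewrite trmxCK -[in RHS]WWW !trmxC_mul trmxCK mulmxA.
Qed.

Lemma unitarymx_mulC n (U : 'M[C]_n) : U \is unitarymx -> U ^t* *m U = 1%:M.
Proof. by rewrite -trmxC_unitary => /unitarymxP; rewrite trmxCK. Qed.

Lemma unitary_contraction n (U : 'M[C]_n) : U \is unitarymx -> mx_contraction U.
Proof.
by move=> /unitarymxP Uu; apply: partial_isometry_contraction; rewrite Uu mul1mx.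
Qed.

Lemma unitary_col n (U : 'M[C]_n) j : U \is unitarymx ->
  \sum_i normc (U i j) ^+ 2 = 1.
Proof.
move=> /unitarymx_mulC Uu; rewrite -[LHS]/(col_sqn U j) -(col_sqn1 j).
by apply: col_sqn_gram; rewrite Uu trmxC1 mul1mx.
Qed.

Lemma unitary_row n (U : 'M[C]_n) i : U \is unitarymx ->
  \sum_j normc (U i j) ^+ 2 = 1.
Proof.
rewrite -trmxC_unitary => /unitary_col => /(_ i) <-.
by apply: eq_bigr => j _; rewrite normc_trmxC.
Qed.

Definition real_diag n (s : 'I_n -> R) : 'M[C]_n := diag_mx (\row_i (s i)%:C).

Lemma real_diagM n (s t : 'I_n -> R) :
  real_diag s *m real_diag t = real_diag (fun i => s i * t i).
Proof.
rewrite mulmx_diag; congr diag_mx; apply/rowP => i.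
by rewrite !mxE rmorphM.
Qed.

Lemma real_diagC n (s : 'I_n -> R) : (real_diag s) ^t* = real_diag s.
Proof.
rewrite tr_diag_mx map_diag_mx; congr diag_mx; apply/rowP => i.
by rewrite !mxE; exact: conjc_real.
Qed.

Lemma mul_mx_real_diag m n (A : 'M[C]_(m, n)) (s : 'I_n -> R) i j :
  (A *m real_diag s) i j = A i j * (s j)%:C.
Proof. by rewrite mul_mx_diag !mxE. Qed.

(* AM-GM bounds the diagonal entries by a doubly substochastic average of s. *)
Lemma sum_powR_diag_le m n (K : 'M[C]_(m, n)) (L : 'M[C]_(n, m))
    (s : 'I_n -> R) (p : R) : 1 <= p -> mx_contraction K -> mx_contraction L ->
  (forall i, 0 <= s i) ->
  \sum_j normc ((K *m real_diag s *m L) j j) `^ p <= \sum_i s i `^ p.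
Proof.
move=> p1 Kc Lc s0.
pose w j i := (normc (K j i) ^+ 2 + normc (L i j) ^+ 2) / 2.
have w0 j i : 0 <= w j i by rewrite divr_ge0// addr_ge0// sqr_ge0.
have w1 j : \sum_i w j i <= 1.
  rewrite -mulr_suml big_split/=.
  have := contraction_row j Kc; have := contraction_col j Lc; lra.
have w2 i : \sum_j w j i <= 1.
  rewrite -mulr_suml big_split/=.
  have := contraction_row i Lc; have := contraction_col i Kc; lra.
apply: (@le_trans _ _ (\sum_j \sum_i w j i * s i `^ p)).
  apply: ler_sum => j _; apply: le_trans (powR_jensen p1 (w0 j) s0 (w1 j)).
  apply: ge0_ler_powR; rewrite ?nnegrE ?normc_ge0//; first lra.
    by apply: sumr_ge0 => i _; rewrite mulr_ge0.
  rewrite mxE (le_trans (normc_sum _))//; apply: ler_sum => i _.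
  rewrite mul_mx_real_diag !normcM normc_real// mulrAC ler_wpM2r//.
  rewrite /w; have := sqr_ge0 (normc (K j i) - normc (L i j)).
  by rewrite sqrrB; lra.
rewrite exchange_big/=; apply: ler_sum => i _; rewrite -mulr_suml.
by rewrite ler_piMl// powR_ge0.
Qed.

End ColumnNorms.

(** * Singular values and sums of their powers *)

Section SchattenSum.
Import ComplexField.Normc.
Local Open Scope sesquilinear_scope.
Local Open Scope complex_scope.
Variable R : realType.
Local Notation C := R[i].

(** The rectangular form is required for rows and columns of blocks. On square matrices it unfolds
    to [singular_value]. *)
Definition rect_singular_value m n (Y : 'M[C]_(m, n)) (j : 'I_n) : R :=
  Num.sqrt (complex.Re (spectral_diag (Y ^t* *m Y) 0 j)).

Definition schatten_sum (p : R) m n (Y : 'M[C]_(m, n)) : R :=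
  \sum_j rect_singular_value Y j `^ p.

Lemma rect_singular_value_ge0 m n (Y : 'M[C]_(m, n)) j :
  0 <= rect_singular_value Y j.
Proof. exact: sqrtr_ge0. Qed.

Lemma schatten_sum_ge0 p m n (Y : 'M[C]_(m, n)) : 0 <= schatten_sum p Y.
Proof. by apply: sumr_ge0 => j _; rewrite powR_ge0. Qed.

(** V consists of eigenvectors of the Gram matrix of Y. The eigenvalues are then squared column
    norms of Y V, hence real and nonnegative, and no information is lost by [complex.Re] or
    [Num.sqrt]. *)
Lemma singular_basis m n (Y : 'M[C]_(m, n)) : exists V : 'M[C]_n,
  [/\ V \is unitarymx,
      (Y *m V) ^t* *m (Y *m V) =
        real_diag (fun j => rect_singular_value Y j ^+ 2) &
      forall j, rect_singular_value Y j = Num.sqrt (col_sqn (Y *m V) j)].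
Proof.
set G := Y ^t* *m Y; pose P := spectralmx G; pose V := P ^t*.
have Pu : P \is unitarymx by exact: spectral_unitarymx.
have Vu : V \is unitarymx by rewrite trmxC_unitary.
have GN : G \is normalmx.
  by apply/normalmxP; rewrite /G trmxC_mul trmxCK.
have E : (Y *m V) ^t* *m (Y *m V) = diag_mx (spectral_diag G).
  have -> : (Y *m V) ^t* *m (Y *m V) = P *m G *m P ^t*.
    by rewrite trmxC_mul trmxCK !mulmxA.
  have GE : G = P ^t* *m diag_mx (spectral_diag G) *m P.
    by rewrite -invmx_unitary//; exact/orthomx_spectralP.
  by rewrite [in LHS]GE !mulmxA (unitarymxP Pu) mul1mx -mulmxA (unitarymxP Pu) mulmx1.
have sv j : spectral_diag G 0 j = (col_sqn (Y *m V) j)%:C.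
  by rewrite -gram_diagE E mxE eqxx.
have rv j : rect_singular_value Y j = Num.sqrt (col_sqn (Y *m V) j).
  by rewrite /rect_singular_value -/G sv.
exists V; split; [exact: Vu| |exact: rv]; rewrite E; congr diag_mx; apply/rowP => j.
by rewrite mxE rv sqr_sqrtr ?col_sqn_ge0// sv.
Qed.

Lemma svd m n (Y : 'M[C]_(m, n)) :
  exists (W : 'M[C]_(m, n)) (V : 'M[C]_n),
  [/\ mx_contraction W, V \is unitarymx,
      Y = W *m real_diag (rect_singular_value Y) *m V ^t* &
      W ^t* *m Y *m V = real_diag (rect_singular_value Y)].
Proof.
have [V [Vu gramV svV]] := singular_basis Y.
set s := rect_singular_value Y in gramV svV *.
(* Since 0^-1 = 0, the columns of W for zero singular values vanish, which makes W a partial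
   isometry. *)
pose D := real_diag (fun j => (s j)^-1); pose Z := Y *m V; pose W := Z *m D.
have ZC : Z = W *m real_diag s.
  apply/matrixP => i j; rewrite !mul_mx_real_diag -mulrA -rmorphM.
  (* A zero singular value means a zero column of Z, so rescaling loses nothing there. *)
  have [sj0|sj0] := eqVneq (s j) 0; last by rewrite mulVf// mulr1.
  have : col_sqn Z j = 0.
    by apply/eqP; rewrite eq_le col_sqn_ge0 andbT -sqrtr_eq0 -svV sj0.
  move=> /eqP; rewrite psumr_eq0 => [/allP/(_ i)|k _]; last exact: sqr_ge0.
  rewrite mem_index_enum => /(_ isT); rewrite sqrf_eq0 => /eqP/eq0_normc ->.
  by rewrite mul0r.
have WZ : W ^t* *m Z = real_diag s.
  rewrite trmxC_mul real_diagC -mulmxA gramV real_diagM; congr diag_mx.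
  apply/rowP => j; rewrite !mxE; congr _%:C.
  by have [->|sj] := eqVneq (s j) 0; rewrite ?expr0n/= ?mulr0// expr2 mulKf.
exists W, V; split=> //.
- apply: partial_isometry_contraction.
  by rewrite -mulmxA {3}/W [W ^t* *m _]mulmxA WZ mulmxA -ZC.
- by rewrite -ZC /Z -mulmxA (unitarymxP Vu) mulmx1.
- by rewrite -mulmxA WZ.
Qed.

(** * Maximum principle over diagonals, and its consequences *)

Lemma schatten_sum_ge p m n k (Y : 'M[C]_(m, n)) (K : 'M[C]_(k, m))
    (L : 'M[C]_(n, k)) : 1 <= p -> mx_contraction K -> mx_contraction L ->
  \sum_j normc ((K *m Y *m L) j j) `^ p <= schatten_sum p Y.
Proof.
move=> p1 Kc Lc; have [W [V [Wc Vu YE _]]] := svd Y.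
(* The outer factors of the singular value decomposition are absorbed into the contractions K and
   L. *)
have -> : K *m Y *m L =
    K *m W *m real_diag (rect_singular_value Y) *m (V ^t* *m L).
  by rewrite {1}YE !mulmxA.
apply: sum_powR_diag_le; [exact: p1| | |exact: rect_singular_value_ge0].
- exact: contractionM.
- apply: contractionM Lc; apply: unitary_contraction.
  by rewrite trmxC_unitary.
Qed.

Lemma schatten_sum_attained m n (Y : 'M[C]_(m, n)) :
  exists (K : 'M[C]_(n, m)) (L : 'M[C]_n),
  [/\ mx_contraction K, mx_contraction L &
      forall p, schatten_sum p Y = \sum_j normc ((K *m Y *m L) j j) `^ p].
Proof.
have [W [V [Wc Vu _ WYV]]] := svd Y.
exists (W ^t*), V; split; [exact: contractionC|exact: unitary_contraction|].
move=> p; apply: eq_bigr => j _; rewrite WYV !mxE eqxx mulr1n normc_real//.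
exact: rect_singular_value_ge0.
Qed.

Lemma schatten_sum_trmxC p m n (Y : 'M[C]_(m, n)) : 1 <= p ->
  schatten_sum p (Y ^t*) = schatten_sum p Y.
Proof.
move=> p1; have half a b (X : 'M[C]_(a, b)) :
    schatten_sum p (X ^t*) <= schatten_sum p X.
  have [K [L [Kc Lc ->]]] := schatten_sum_attained (X ^t*).
  have := schatten_sum_ge X p1 (contractionC Lc) (contractionC Kc).
  apply: le_trans; apply: ler_sum => j _.
  (* Taking adjoints exchanges the two contractions and preserves the moduli on the diagonal. The
     reverse inequality follows since the adjoint is an involution. *)
  have -> : L ^t* *m X *m K ^t* = (K *m X ^t* *m L) ^t*.
    by rewrite !trmxC_mul trmxCK mulmxA.
  by rewrite normc_trmxC.
by apply/eqP; rewrite eq_le half -{1}[Y]trmxCK half.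
Qed.

Lemma schatten_sum_unimodular p m n (Y : 'M[C]_(m, n)) (c : C) :
  normc c = 1 -> schatten_sum p (c *: Y) = schatten_sum p Y.
Proof.
move=> c1; rewrite /schatten_sum /rect_singular_value.
suff -> : (c *: Y) ^t* *m (c *: Y) = Y ^t* *m Y by [].
have -> : (c *: Y) ^t* = Num.conj c *: Y ^t*.
  by apply/matrixP => i j; rewrite !mxE rmorphM.
rewrite -scalemxAl -scalemxAr scalerA.
by rewrite -normCKC norm_normc c1 expr1n scale1r.
Qed.

Lemma schatten_sum_scale p m n (Y : 'M[C]_(m, n)) (c : R) : 1 <= p -> 0 <= c ->
  schatten_sum p (c%:C *: Y) <= c `^ p * schatten_sum p Y.
Proof.
move=> p1 c0; have [K [L [Kc Lc ->]]] := schatten_sum_attained (c%:C *: Y).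
apply: le_trans (ler_wpM2l (powR_ge0 _ _) (schatten_sum_ge Y p1 Kc Lc)).
rewrite mulr_sumr; apply: ler_sum => j _.
rewrite -scalemxAr -scalemxAl mxE normcM normc_real// powRM//.
exact: normc_ge0.
Qed.

(** Contractions that are optimal for X + Y are admissible for X and for Y; Minkowski's inequality
    is applied to the diagonals. *)
Lemma schatten_sum_triangle p m n (X Y : 'M[C]_(m, n)) : 1 <= p ->
  schatten_sum p (X + Y) `^ p^-1 <=
  schatten_sum p X `^ p^-1 + schatten_sum p Y `^ p^-1.
Proof.
move=> p1; have [K [L [Kc Lc ->]]] := schatten_sum_attained (X + Y).
have p0 : 0 <= p by lra.
have nn I (s : seq I) (F : I -> R) : 0 <= \sum_(i <- s) F i `^ p.
  by apply: sumr_ge0 => i _; rewrite powR_ge0.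
apply: (@le_trans _ _ ((\sum_j (normc ((K *m X *m L) j j) +
    normc ((K *m Y *m L) j j)) `^ p) `^ p^-1)).
  apply: ge0_ler_powR; rewrite ?nnegrE ?invr_ge0//.
  apply: ler_sum => j _; apply: ge0_ler_powR; rewrite ?nnegrE ?normc_ge0//.
    by rewrite addr_ge0 ?normc_ge0.
  by rewrite mulmxDr mulmxDl mxE le_normcD.
apply: le_trans (minkowski_sum p1 (fun=> normc_ge0 _) (fun=> normc_ge0 _)) _.
by apply: lerD; apply: ge0_ler_powR; rewrite ?nnegrE ?invr_ge0//;
  [exact: schatten_sum_ge0|exact: schatten_sum_ge|
   exact: schatten_sum_ge0|exact: schatten_sum_ge].
Qed.

(** * Extremal principles over orthonormal bases *)

Lemma schatten_sum_basis m n (Y : 'M[C]_(m, n)) : exists2 V : 'M[C]_n,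
  V \is unitarymx &
  forall p, schatten_sum p Y = \sum_j col_sqn (Y *m V) j `^ (p / 2).
Proof.
have [V [Vu _ svV]] := singular_basis Y; exists V => // p.
apply: eq_bigr => j _.
by rewrite svV -powR12_sqrt ?col_sqn_ge0// -powRrM mulrC.
Qed.

(* In the singular basis the squared column norms of [Y *m U] are averages of
   the squared singular values with doubly stochastic weights. *)
Lemma col_sqn_unitary m n (Y : 'M[C]_(m, n)) (U : 'M[C]_n) :
  U \is unitarymx -> exists w : 'I_n -> 'I_n -> R,
  [/\ forall j k, 0 <= w j k, forall j, \sum_k w j k = 1,
      forall k, \sum_j w j k = 1 &
      forall j, col_sqn (Y *m U) j =
        \sum_k w j k * rect_singular_value Y k ^+ 2].
Proof.
move=> Uu; have [V [Vu gramV _]] := singular_basis Y.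
pose Q := V ^t* *m U.
have Qu : Q \is unitarymx by apply: mul_unitarymx Uu; rewrite trmxC_unitary.
have YU : Y *m U = Y *m V *m Q.
  by rewrite /Q mulmxA -(mulmxA Y) (unitarymxP Vu) mulmx1.
clearbody Q; exists (fun j k => normc (Q k j) ^+ 2); split=> [j k|j|k|j].
- exact: sqr_ge0.
- exact: unitary_col.
- exact: unitary_row.
apply: (@complexI R); rewrite YU -gram_diagE trmxC_mul mulmxA -(mulmxA _ _ (Y *m V)).
rewrite gramV mxE rmorph_sum; apply: eq_bigr => k _.
rewrite mul_mx_real_diag !mxE mulrAC -normCKC norm_normc.
by rewrite [in RHS]rmorphM [in RHS]rmorphXn.
Qed.

Lemma sqr_powR_half (x p : R) : 0 <= x -> (x ^+ 2) `^ (p / 2) = x `^ p.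
Proof.
by move=> x0; rewrite -powR_mulrn// -powRrM mulrCA divff ?mulr1// pnatr_eq0.
Qed.

(** Concavity of x^(p/2) for each row of weights; summing over j then restores the singular values,
    because the weights are doubly stochastic. *)
Lemma schatten_sum_le_cols p m n (Y : 'M[C]_(m, n)) (U : 'M[C]_n) :
  0 < p <= 2 -> U \is unitarymx ->
  schatten_sum p Y <= \sum_j col_sqn (Y *m U) j `^ (p / 2).
Proof.
move=> p02 /(col_sqn_unitary Y)[w [w0 w1 w2 colE]].
have -> : schatten_sum p Y =
    \sum_j \sum_k w j k * (rect_singular_value Y k ^+ 2) `^ (p / 2).
  rewrite exchange_big/=; apply: eq_bigr => k _.
  by rewrite -mulr_suml w2 mul1r sqr_powR_half// rect_singular_value_ge0.
apply: ler_sum => j _; rewrite colE; apply: powR_jensen_concave => //.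
- lra.
- by move=> k; rewrite sqr_ge0.
- by rewrite w1.
Qed.

(** The same averaging, now with x^(p/2) convex. *)
Lemma schatten_sum_ge_cols p m n (Y : 'M[C]_(m, n)) (U : 'M[C]_n) :
  2 <= p -> U \is unitarymx ->
  \sum_j col_sqn (Y *m U) j `^ (p / 2) <= schatten_sum p Y.
Proof.
move=> p2 /(col_sqn_unitary Y)[w [w0 w1 w2 colE]].
have -> : schatten_sum p Y =
    \sum_j \sum_k w j k * (rect_singular_value Y k ^+ 2) `^ (p / 2).
  rewrite exchange_big/=; apply: eq_bigr => k _.
  by rewrite -mulr_suml w2 mul1r sqr_powR_half// rect_singular_value_ge0.
apply: ler_sum => j _; rewrite colE; apply: powR_jensen => //.
- lra.
- by move=> k; rewrite sqr_ge0.
- by rewrite w1.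
Qed.

(** * Estimates for block matrices *)

Lemma schatten_sum_row_mx p m n1 n2 (X : 'M[C]_(m, n1)) (Y : 'M[C]_(m, n2)) :
  0 < p <= 2 -> schatten_sum p (row_mx X Y) <= schatten_sum p X + schatten_sum p Y.
Proof.
move=> p02; have [U Uu ->] := schatten_sum_basis X.
have [V Vu ->] := schatten_sum_basis Y.
(* The two singular bases together form a test basis, in which the columns of the row block are
   those of X U followed by those of Y V. *)
have UVu : block_mx U 0 0 V \is unitarymx.
  apply/unitarymxP; rewrite tr_block_mx map_block_mx mulmx_block.
  rewrite (unitarymxP Uu) (unitarymxP Vu) !trmx0 !map_mx0 !mulmx0 !mul0mx.
  by rewrite !addr0 add0r -scalar_mx_block.
apply: (le_trans (schatten_sum_le_cols _ p02 UVu)).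
rewrite mul_row_block !mulmx0 addr0 add0r big_split_ord/=.
by apply: lerD; apply: ler_sum => j _; rewrite (col_sqn_row_mxl, col_sqn_row_mxr).
Qed.

Lemma schatten_sum_col_mx p m1 m2 n (X : 'M[C]_(m1, n)) (Y : 'M[C]_(m2, n)) :
  2 <= p -> schatten_sum p (col_mx X Y) <=
            2 `^ (p / 2 - 1) * (schatten_sum p X + schatten_sum p Y).
Proof.
move=> p2; have [V Vu ->] := schatten_sum_basis (col_mx X Y).
(* In a basis optimal for the stack, squared column norms add, and convexity of x^(p/2) costs the
   factor. The same basis bounds both blocks from below. *)
apply: (@le_trans _ _ (2 `^ (p / 2 - 1) *
    (\sum_j col_sqn (X *m V) j `^ (p / 2) + \sum_j col_sqn (Y *m V) j `^ (p / 2)))).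
  rewrite -big_split mulr_sumr; apply: ler_sum => j _.
  rewrite mul_col_mx col_sqn_col_mx powR_add_convex ?col_sqn_ge0//; lra.
by rewrite ler_wpM2l ?powR_ge0// lerD// schatten_sum_ge_cols.
Qed.

Lemma schatten_sum_block_le2 p m1 m2 n1 n2 (A : 'M[C]_(m1, n1))
    (B : 'M[C]_(m1, n2)) (D : 'M[C]_(m2, n1)) (E : 'M[C]_(m2, n2)) :
  1 <= p <= 2 -> schatten_sum p (block_mx A B D E) <=
    schatten_sum p A + schatten_sum p B + (schatten_sum p D + schatten_sum p E).
Proof.
move=> p12; have p02 : 0 < p <= 2 by lra.
have p1 : 1 <= p by lra.
(* Passing to the adjoint turns the stack of two block rows into a row, to which the previous
   estimate applies. *)
rewrite -(schatten_sum_trmxC _ p1) block_mxEv tr_col_mx map_row_mx.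
apply: (le_trans (schatten_sum_row_mx _ _ p02)).
by rewrite !schatten_sum_trmxC// lerD// schatten_sum_row_mx.
Qed.

Lemma schatten_sum_block_ge2 p m1 m2 n1 n2 (A : 'M[C]_(m1, n1))
    (B : 'M[C]_(m1, n2)) (D : 'M[C]_(m2, n1)) (E : 'M[C]_(m2, n2)) :
  2 <= p -> schatten_sum p (block_mx A B D E) <= 2 `^ (p - 2) *
   (schatten_sum p A + schatten_sum p B + (schatten_sum p D + schatten_sum p E)).
Proof.
move=> p2; have p1 : 1 <= p by lra.
(* One factor for separating the block rows, one for splitting each of them. *)
have -> : p - 2 = (p / 2 - 1) + (p / 2 - 1) by lra.
rewrite powRD ?pnatr_eq0 ?implybT// -mulrA mulrDr block_mxEv.
apply: (le_trans (schatten_sum_col_mx _ _ p2)).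
rewrite ler_wpM2l ?powR_ge0//; apply: lerD.
  rewrite -(schatten_sum_trmxC _ p1) tr_row_mx map_col_mx.
  by rewrite (le_trans (schatten_sum_col_mx _ _ p2))// !schatten_sum_trmxC.
rewrite -(schatten_sum_trmxC _ p1) tr_row_mx map_col_mx.
by rewrite (le_trans (schatten_sum_col_mx _ _ p2))// !schatten_sum_trmxC.
Qed.

End SchattenSum.

(** * The Schatten numerical radius and its blocks *)

Section NumericalRadius.
Import ComplexField.Normc.
Local Open Scope sesquilinear_scope.
Local Open Scope complex_scope.
Variable R : realType.
Local Notation C := R[i].

Lemma schatten_normE p n (Y : 'M[C]_n) :
  schatten_norm p Y = schatten_sum p Y `^ p^-1.
Proof. by []. Qed.

Lemma schatten_norm_ge0 p n (Y : 'M[C]_n) : 0 <= schatten_norm p Y.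
Proof. exact: powR_ge0. Qed.

Lemma schatten_norm_powR p n (Y : 'M[C]_n) : 1 <= p ->
  schatten_norm p Y `^ p = schatten_sum p Y.
Proof.
move=> p1; rewrite schatten_normE -powRrM mulVf ?gt_eqF ?powRr1//; last by lra.
exact: schatten_sum_ge0.
Qed.

Lemma normc_expi (t : R) : normc (expi t) = 1.
Proof. by rewrite /= cos2Dsin2 sqrtr1. Qed.

(** Triangle inequality, with invariance under adjoints and unimodular factors. It serves for the
    off-diagonal blocks and, with X = Y, for the boundedness of the real parts. *)
Lemma schatten_sum_half_add p n (X Y : 'M[C]_n) (c : C) : 1 <= p ->
  normc c = 1 -> schatten_sum p (2^-1 *: (c *: X + (c *: Y) ^t*)) <=
    ((schatten_norm p X + schatten_norm p Y) / 2) `^ p.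
Proof.
move=> p1 c1.
have -> : 2^-1 = (2^-1 : R)%:C :> C by rewrite fmorphV rmorph_nat.
apply: le_trans (schatten_sum_scale _ p1 _) _; first by rewrite invr_ge0.
rewrite mulrC powRM ?invr_ge0 ?addr_ge0 ?schatten_norm_ge0//.
rewrite ler_wpM2r ?powR_ge0// -schatten_norm_powR//.
apply: ge0_ler_powR; rewrite ?nnegrE ?addr_ge0 ?schatten_norm_ge0//; first lra.
rewrite schatten_normE; apply: le_trans (schatten_sum_triangle _ _ p1) _.
rewrite (schatten_sum_trmxC (c *: Y) p1).
by rewrite (schatten_sum_unimodular p X c1) (schatten_sum_unimodular p Y c1).
Qed.

(** The Schatten norm of Y is an upper bound; this excludes the default value 0 of [sup]. *)
Lemma schatten_numrad_has_sup p n (Y : 'M[C]_n) : 1 <= p ->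
  has_sup [set schatten_norm p (re_mx (expi t *: Y)) | t in [set: R]]%classic.
Proof.
move=> p1; split; first by exists (schatten_norm p (re_mx (expi 0 *: Y))), 0.
exists (schatten_norm p Y) => _ [t _ <-].
have p0 : 0 < p by lra.
have := schatten_sum_half_add Y Y p1 (normc_expi t).
have -> : (schatten_norm p Y + schatten_norm p Y) / 2 = schatten_norm p Y by lra.
rewrite -[2^-1 *: _]/(re_mx (expi t *: Y)) -(schatten_norm_powR _ p1).
apply: powR_le_inv => //; exact: schatten_norm_ge0.
Qed.

Lemma schatten_numrad_ge p n (Y : 'M[C]_n) t : 1 <= p ->
  schatten_norm p (re_mx (expi t *: Y)) <= schatten_numrad p Y.
Proof.
by move=> p1; apply: (ub_le_sup (schatten_numrad_has_sup Y p1).2); exists t.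
Qed.

Lemma schatten_sum_le_numrad p n (Y : 'M[C]_n) t : 1 <= p ->
  schatten_sum p (re_mx (expi t *: Y)) <= schatten_numrad p Y `^ p.
Proof.
move=> p1; have le := schatten_numrad_ge Y t p1.
have x0 := schatten_norm_ge0 p (re_mx (expi t *: Y)).
rewrite -(schatten_norm_powR _ p1); apply: ge0_ler_powR; rewrite ?nnegrE//.
  lra.
exact: le_trans le.
Qed.

Lemma schatten_numrad_powR_le p n (Y : 'M[C]_n) (M : R) : 1 <= p ->
  (forall t, schatten_sum p (re_mx (expi t *: Y)) <= M) ->
  schatten_numrad p Y `^ p <= M.
Proof.
move=> p1 leM; have p0 : 0 < p by lra.
have M0 : 0 <= M := le_trans (schatten_sum_ge0 _ _) (leM 0).
have -> : M = (M `^ p^-1) `^ p by rewrite -powRrM mulVf ?gt_eqF ?powRr1.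
have w0 : 0 <= schatten_numrad p Y.
  exact: le_trans (schatten_norm_ge0 _ _) (schatten_numrad_ge Y 0 p1).
apply: ge0_ler_powR; rewrite ?nnegrE ?powR_ge0// ?(ltW p0)//.
apply: ge_sup => [|_ [t _ <-]]; first exact: (schatten_numrad_has_sup Y p1).1.
rewrite schatten_normE; apply: ge0_ler_powR; rewrite ?nnegrE ?invr_ge0 ?(ltW p0)//.
exact: schatten_sum_ge0.
Qed.

Lemma re_mx_block n (A B D E : 'M[C]_n) (c : C) :
  re_mx (c *: (block_mx A B D E : 'M[C]_(n + n))) =
  block_mx (re_mx (c *: A)) (2^-1 *: (c *: B + (c *: D) ^t*))
           (2^-1 *: (c *: D + (c *: B) ^t*)) (re_mx (c *: E)).
Proof.
by rewrite /re_mx scale_block_mx tr_block_mx map_block_mx add_block_mx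
  scale_block_mx.
Qed.

(** Source of the constant 1 / 2^(p - 1): two off-diagonal blocks, each contributing (b / 2)^p. *)
Lemma two_half_powR (p b : R) : 0 <= b ->
  (b / 2) `^ p + (b / 2) `^ p = 1 / 2 `^ (p - 1) * b `^ p.
Proof.
move=> b0; rewrite powRM ?invr_ge0// -[2^-1]powR_inv1// powRAC powR_inv1 ?powR_ge0//.
rewrite powRB ?pnatr_eq0 ?implybT// powRr1//.
have : 2 `^ p != 0 :> R by rewrite gt_eqF// powR_gt0.
by move=> ?; field.
Qed.

(** The part of the estimate common to both ranges of p, uniform in the angle t. *)
Lemma schatten_sum_blocks_le p n (A B D E : 'M[C]_n) t : 1 <= p ->
  schatten_sum p (re_mx (expi t *: A)) +
  schatten_sum p (2^-1 *: (expi t *: B + (expi t *: D) ^t*)) +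
  (schatten_sum p (2^-1 *: (expi t *: D + (expi t *: B) ^t*)) +
   schatten_sum p (re_mx (expi t *: E))) <=
  schatten_numrad p A `^ p + schatten_numrad p E `^ p +
  1 / 2 `^ (p - 1) * (schatten_norm p B + schatten_norm p D) `^ p.
Proof.
move=> p1; rewrite -two_half_powR ?addr_ge0 ?schatten_norm_ge0//.
have hBD := schatten_sum_half_add B D p1 (normc_expi t).
have hDB := schatten_sum_half_add D B p1 (normc_expi t).
rewrite [X in X / 2]addrC in hDB.
have hA := schatten_sum_le_numrad A t p1.
have hE := schatten_sum_le_numrad E t p1.
apply: le_trans (lerD (lerD hA hBD) (lerD hDB hE)) _.
by rewrite [X in _ + X <= _]addrC addrACA.
Qed.

End NumericalRadius.

Theorem theorem1p2 (R : realType) (n : nat) (A B C D : 'M[R[i]]_n) :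
  let T : 'M[R[i]]_(n + n) := block_mx A B C D in
  (forall p : R, 2 <= p ->
    schatten_numrad p T `^ p <=
      1 / 2 `^ (2 - p) *
      (schatten_numrad p A `^ p + schatten_numrad p D `^ p +
       1 / 2 `^ (p - 1) * (schatten_norm p B + schatten_norm p C) `^ p)) /\
  (forall p : R, 1 <= p <= 2 ->
    schatten_numrad p T `^ p <=
      schatten_numrad p A `^ p + schatten_numrad p D `^ p +
      1 / 2 `^ (p - 1) * (schatten_norm p B + schatten_norm p C) `^ p).
Proof.
move=> T; split=> p hp.
  have p1 : 1 <= p by lra.
  apply: schatten_numrad_powR_le => // t; rewrite re_mx_block.
  apply: le_trans (schatten_sum_block_ge2 _ _ _ _ hp) _.
  (* The stated constant is the price of splitting into four blocks. *)
  have -> : 1 / 2 `^ (2 - p) = 2 `^ (p - 2) :> R.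
    by rewrite -[2 - p]opprB powRN div1r invrK.
  apply: ler_wpM2l; first exact: powR_ge0.
  exact: schatten_sum_blocks_le.
have /andP[p1 _] := hp.
apply: schatten_numrad_powR_le => // t; rewrite re_mx_block.
apply: le_trans (schatten_sum_block_le2 _ _ _ _ hp) _.
exact: schatten_sum_blocks_le.
Qed.
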